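(* Let $\Bbbk$ be a field and let $A$ and $B$ be non-semisimple finite-dimensional $\Bbbk$-algebras. If $A$ is directed and $B$ is self-injective, then $A$ and $B$ are not separably related, i.e. neither does $A$ separably divide $B$, nor does $B$ separably divide $A$.
   Context: All algebras are finite-dimensional, associative, unital $\Bbbk$-algebras, and all (bi)modules are finite-dimensional. $A$ is directed means $A=\Bbbk Q/I$ with $Q$ a finite acyclic quiver and $I$ an admissible ideal of $\Bbbk Q$. An $A$-$B$-bimodule $M$ is left-right projective if ${}_AM$ is a projective left $A$-module and $M_B$ is a projective right $B$-module. $A$ separably divides $B$ if there are left-right projective bimodules ${}_AM_B$ and ${}_BN_A$ such that the regular bimodule ${}_AA_A$ is a direct summand of $M\otimes_B N$ as $A$-$A$-bimodule. *)

(* Defs.v *)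
From HB Require Import structures.
From mathcomp Require Import all_boot all_algebra all_field.
From mathcomp Require Import finmap.
From mathcomp Require Import monalg.

Set Implicit Arguments.
Unset Strict Implicit.
Unset Printing Implicit Defensive.

Import GRing.Theory.
Local Open Scope ring_scope.

Section Modules.
Variable R : pzRingType.

Definition projective_module (P : lmodType R) : Prop :=
  forall (X Y : lmodType R) (g : {linear X -> Y}) (f : {linear P -> Y}),
    (forall y, exists x, g x = y) ->
    exists h : {linear P -> X}, forall p, g (h p) = f p.

Definition injective_module (E : lmodType R) : Prop :=
  forall (X Y : lmodType R) (g : {linear X -> Y}) (f : {linear X -> E}),
    injective g ->
    exists h : {linear Y -> E}, forall x, h (g x) = f x.

End Modules.

Section Algebras.
Variables (k : fieldType) (A : falgType k).

(* For finite-dimensional algebras, left and right self-injectivity agree. *)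
Definition self_injective : Prop := injective_module (A^o : lmodType A).

Definition left_ideal (U : {vspace A}) : bool := (fullv * U <= U)%VS.

Definition simple_left_ideal (U : {vspace A}) : Prop :=
  [/\ left_ideal U, U != 0%VS
    & forall V : {vspace A}, left_ideal V -> (V <= U)%VS -> V = 0%VS \/ V = U].

(* The left regular module is a direct sum of simple submodules; its submodules
   are left ideals, hence subspaces. *)
Definition semisimple : Prop :=
  exists (n : nat) (S : 'I_n -> {vspace A}),
    [/\ forall i, simple_left_ideal (S i),
        directv (\sum_i S i) & (\sum_i S i)%VS = fullv].

End Algebras.

(* [A]-[B]-bimodules on which [k] acts centrally: both actions are [k]-linear
   in the algebra and in the module.  [ract b m] is [m b]. *)
Record bimod (k : fieldType) (A B : falgType k) := Bimod {
  bimod_sort :> vectType k;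
  lact : {linear A -> 'End(bimod_sort)};
  ract : {linear B -> 'End(bimod_sort)};
  lact1 : lact 1 = \1%VF;
  lactM : forall a a', lact (a * a') = (lact a \o lact a')%VF;
  ract1 : ract 1 = \1%VF;
  ractM : forall b b', ract (b * b') = (ract b' \o ract b)%VF;
  lract : forall a b, (lact a \o ract b = ract b \o lact a)%VF
}.

Section Bimodules.
Variables (k : fieldType) (A B : falgType k).
Implicit Types X Y Z : bimod A B.

Lemma lractE X a b x : lact X a (ract X b x) = ract X b (lact X a x).
Proof. by have /lfunP/(_ x) := lract X a b; rewrite !comp_lfunE. Qed.

Definition left_module X : Type := X.
HB.instance Definition _ X := GRing.Zmodule.on (left_module X).

Definition right_module X : Type := X.
HB.instance Definition _ X := GRing.Zmodule.on (right_module X).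

Section Actions.
Variable X : bimod A B.

Let ls (a : A) (x : left_module X) : left_module X := lact X a x.
Fact ls_A a b x : ls a (ls b x) = ls (a * b) x.
Proof. by rewrite /ls lactM comp_lfunE. Qed.
Fact ls_1 : left_id 1 ls.
Proof. by move=> x; rewrite /ls lact1 id_lfunE. Qed.
Fact ls_Dr : right_distributive ls +%R.
Proof. by move=> a x y; rewrite /ls linearD. Qed.
Fact ls_Dl x : {morph ls^~ x : a b / a + b}.
Proof. by move=> a b; rewrite /ls linearD add_lfunE. Qed.
HB.instance Definition _ :=
  GRing.Zmodule_isLmodule.Build A (left_module X) ls_A ls_1 ls_Dr ls_Dl.

(* Right [B]-modules are modules over the converse ring [B^c]. *)
Let rs (b : B^c) (x : right_module X) : right_module X := ract X b x.
Fact rs_A a b x : rs a (rs b x) = rs (a * b) x.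
Proof. by rewrite /rs ractM comp_lfunE. Qed.
Fact rs_1 : left_id 1 rs.
Proof. by move=> x; rewrite /rs ract1 id_lfunE. Qed.
Fact rs_Dr : right_distributive rs +%R.
Proof. by move=> a x y; rewrite /rs linearD. Qed.
Fact rs_Dl x : {morph rs^~ x : a b / a + b}.
Proof. by move=> a b; rewrite /rs linearD add_lfunE. Qed.
HB.instance Definition _ :=
  GRing.Zmodule_isLmodule.Build B^c (right_module X) rs_A rs_1 rs_Dr rs_Dl.

End Actions.

Definition left_right_projective X : Prop :=
  projective_module (left_module X : lmodType A) /\
  projective_module (right_module X : lmodType B^c).

Definition bimod_iso X Y : Prop :=
  exists f : 'Hom(X, Y),
    [/\ bijective f,
        forall a x, f (lact X a x) = lact Y a (f x)
      & forall b x, f (ract X b x) = ract Y b (f x)].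

Section DirectSum.
Variables X Y : bimod A B.
Notation XY := (X * Y)%type.

Definition pair_fun (f : 'End(X)) (g : 'End(Y)) (z : XY) : XY := (f z.1, g z.2).
Fact pair_fun_linear f g : linear (pair_fun f g).
Proof. by move=> c [x y] [x' y']; rewrite /pair_fun /= !linearP. Qed.
HB.instance Definition _ f g :=
  GRing.isLinear.Build k XY XY _ (pair_fun f g) (pair_fun_linear f g).

Definition dsum_lact a : 'End(XY) := linfun (pair_fun (lact X a) (lact Y a)).
Fact dsum_lact_linear : linear dsum_lact.
Proof.
move=> c a a'; apply/lfunP => z; rewrite !lfun_simp /= /pair_fun !linearP.
by rewrite !lfun_simp.
Qed.
HB.instance Definition _ :=
  GRing.isLinear.Build k A 'End(XY) _ dsum_lact dsum_lact_linear.

Definition dsum_ract b : 'End(XY) := linfun (pair_fun (ract X b) (ract Y b)).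
Fact dsum_ract_linear : linear dsum_ract.
Proof.
move=> c a a'; apply/lfunP => z; rewrite !lfun_simp /= /pair_fun !linearP.
by rewrite !lfun_simp.
Qed.
HB.instance Definition _ :=
  GRing.isLinear.Build k B 'End(XY) _ dsum_ract dsum_ract_linear.

Fact dsum_lact1 : dsum_lact 1 = \1%VF.
Proof.
by apply/lfunP => -[x y]; rewrite !lfun_simp /= /pair_fun !lact1 !lfun_simp.
Qed.
Fact dsum_lactM a a' : dsum_lact (a * a') = (dsum_lact a \o dsum_lact a')%VF.
Proof.
by apply/lfunP => z; rewrite !lfun_simp /= /pair_fun !lactM !lfun_simp.
Qed.
Fact dsum_ract1 : dsum_ract 1 = \1%VF.
Proof.
by apply/lfunP => -[x y]; rewrite !lfun_simp /= /pair_fun !ract1 !lfun_simp.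
Qed.
Fact dsum_ractM b b' : dsum_ract (b * b') = (dsum_ract b' \o dsum_ract b)%VF.
Proof.
by apply/lfunP => z; rewrite !lfun_simp /= /pair_fun !ractM !lfun_simp.
Qed.
Fact dsum_lract a b :
  (dsum_lact a \o dsum_ract b = dsum_ract b \o dsum_lact a)%VF.
Proof.
by apply/lfunP => z; rewrite !lfun_simp /= /pair_fun /= !lractE.
Qed.

Definition dsum : bimod A B :=
  Bimod dsum_lact1 dsum_lactM dsum_ract1 dsum_ractM dsum_lract.

End DirectSum.

Definition direct_summand X Y : Prop := exists Z, bimod_iso Y (dsum X Z).

End Bimodules.

Section Regular.
Variables (k : fieldType) (A : falgType k).

Fact regular_lactM (a a' : A) : amull (a * a') = (amull a \o amull a')%VF.
Proof. by apply/lfunP => x; rewrite !lfun_simp /= mulrA. Qed.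
Fact regular_ract1 : amulr (1 : A) = \1%VF.
Proof. by apply/lfunP => x; rewrite !lfun_simp /= mulr1. Qed.
Fact regular_ractM (b b' : A) : amulr (b * b') = (amulr b' \o amulr b)%VF.
Proof. by apply/lfunP => x; rewrite !lfun_simp /= mulrA. Qed.
Fact regular_lract (a b : A) : (amull a \o amulr b = amulr b \o amull a)%VF.
Proof. by apply/lfunP => x; rewrite !lfun_simp /= mulrA. Qed.

Definition regular_bimod : bimod A A :=
  Bimod (amull1 A) regular_lactM regular_ract1 regular_ractM regular_lract.

End Regular.

Lemma linear_basis0 (k : fieldType) (V W : vectType k) (f : V -> W) :
  linear f -> {in vbasis {:V}, forall v, f v = 0} -> forall v, f v = 0.
Proof.
move=> f_lin; pose fL := GRing.isLinear.Build _ _ _ _ f f_lin.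
have: forall g : {linear V -> W}, {in vbasis {:V}, forall v, g v = 0} ->
  forall v, g v = 0; last by move/(_ (HB.pack f fL)).
move=> g g0 v; rewrite (coord_vbasis (memvf v)) linear_sum big1 // => i _.
by rewrite linearZ /= g0 ?scaler0 // mem_nth // size_tuple.
Qed.

Section TensorSpace.
Import passmx.
Variables (k : fieldType) (M N : vectType k).

(* [M] tensor [N] over [k], encoded by matrices of coordinates. *)
Notation MN := 'M[k]_(\dim {:M}, \dim {:N}).

Definition outer (m : M) (n : N) : MN :=
  (rVof (vbasis fullv) m)^T *m rVof (vbasis fullv) n.

Definition outer_lift (W : vectType k) (h : M -> N -> W) (X : MN) : W :=
  \sum_i \sum_j X i j *: h (vbasis fullv)`_i (vbasis fullv)`_j.

Fact outer_lift_linear (W : vectType k) (h : M -> N -> W) :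
  linear (outer_lift h).
Proof.
move=> c X Y; rewrite /outer_lift scaler_sumr -big_split; apply: eq_bigr => i _.
rewrite scaler_sumr -big_split; apply: eq_bigr => j _.
by rewrite !mxE scalerDl scalerA.
Qed.
HB.instance Definition _ (W : vectType k) h :=
  GRing.isLinear.Build k MN W _ (@outer_lift W h) (@outer_lift_linear W h).

Definition bilinear_map (W : lmodType k) (h : M -> N -> W) : Prop :=
  (forall n, linear (h^~ n)) /\ (forall m, linear (h m)).

Lemma bilinear_mapE (W : lmodType k) (h : M -> N -> W) : bilinear_map h ->
  (forall c m m' n, h (c *: m + m') n = c *: h m n + h m' n) *
  (forall c m n n', h m (c *: n + n') = c *: h m n + h m n').
Proof. by case=> hl hr; split=> *; [apply: hl|apply: hr]. Qed.

Lemma outer_bilinear : bilinear_map outer.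
Proof.
split=> [n c m m'|m c n n']; rewrite /outer linearP.
  by rewrite linearP /= mulmxDl scalemxAl.
by rewrite mulmxDr scalemxAr.
Qed.

Lemma outer_basis (i : 'I_(\dim {:M})) (j : 'I_(\dim {:N})) :
  outer (vbasis fullv)`_i (vbasis fullv)`_j = delta_mx i j.
Proof. by rewrite /outer !rVofE ?vbasisP // trmx_delta mul_delta_mx. Qed.

Lemma outer_liftE (W : vectType k) (h : M -> N -> W) m n :
  bilinear_map h -> outer_lift h (outer m n) = h m n.
Proof.
move=> /bilinear_mapE[hl hr]; have [ol or] := bilinear_mapE outer_bilinear.
pose d m n := outer_lift h (outer m n) - h m n.
have dl n' : linear (d^~ n').
  by move=> c x y; rewrite /d ol hl linearP scalerBr opprD addrACA.
have dr m' : linear (d m').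
  by move=> c x y; rewrite /d or hr linearP scalerBr opprD addrACA.
apply/eqP; rewrite -subr_eq0; apply/eqP.
apply: (linear_basis0 (dl n)) => _ /tnthP[i ->].
apply: (linear_basis0 (dr _)) => _ /tnthP[j ->].
rewrite /d !(tnth_nth 0) outer_basis /outer_lift (bigD1 i) //= (bigD1 j) //=.
rewrite mxE !eqxx scale1r !big1 ?addr0 ?subrr // => [i' /negPf ne|j' /negPf ne].
  by rewrite big1 // => j' _; rewrite mxE ne scale0r.
by rewrite mxE ne andbF scale0r.
Qed.

Lemma outer_ext (W : lmodType k) (f g : {linear MN -> W}) :
  (forall m n, f (outer m n) = g (outer m n)) -> f =1 g.
Proof.
move=> fg X; rewrite (matrix_sum_delta X) !linear_sum; apply: eq_bigr => i _.
rewrite !linear_sum; apply: eq_bigr => j _; rewrite !linearZ.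
by rewrite -outer_basis fg.
Qed.

End TensorSpace.

Section Tensor.
Variables (k : fieldType) (A B C : falgType k).
Variables (M : bimod A B) (N : bimod B C).

(* By trilinearity it is enough to impose [m b (x) n = m (x) b n] for [m], [b]
   and [n] in bases. *)
Definition balancing : {vspace 'M[k]_(\dim {:M}, \dim {:N})} :=
  (\sum_(m <- vbasis {:M}) \sum_(b <- vbasis {:B}) \sum_(n <- vbasis {:N})
     <[outer (ract M b m) n - outer m (lact N b n)]>)%VS.

(* The quotient by [balancing], realized on a complement. *)
Definition tensor_space := subvs_of (balancing^C).
HB.instance Definition _ := Vector.on tensor_space.

Definition tensor_proj (X : 'M[k]_(\dim {:M}, \dim {:N})) : tensor_space :=
  Subvs (memv_projC balancing X).
Fact tensor_proj_linear : linear tensor_proj.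
Proof.
move=> c X Y; apply: val_inj; rewrite /= linearP /= scalerBr opprD addrACA.
by [].
Qed.
HB.instance Definition _ :=
  GRing.isLinear.Build k 'M[k]_(\dim {:M}, \dim {:N}) tensor_space _
    tensor_proj tensor_proj_linear.

Definition tens (m : M) (n : N) : tensor_space := tensor_proj (outer m n).

Definition balanced_map (W : lmodType k) (h : M -> N -> W) : Prop :=
  forall m b n, h (ract M b m) n = h m (lact N b n).

Definition tensor_lift (W : vectType k) (h : M -> N -> W) (t : tensor_space) :
    W := outer_lift h (vsval t).
Fact tensor_lift_linear (W : vectType k) (h : M -> N -> W) :
  linear (tensor_lift h).
Proof. by move=> c t u; rewrite /tensor_lift !linearP. Qed.
HB.instance Definition _ (W : vectType k) h :=
  GRing.isLinear.Build k tensor_space W _ (@tensor_lift W h)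
    (@tensor_lift_linear W h).

Lemma tens_bilinear : bilinear_map tens.
Proof.
have [ol or] := outer_bilinear M N.
by split=> [n c m m'|m c n n']; rewrite /tens (ol, or) linearP.
Qed.

Lemma tensor_proj_eq0 X : (tensor_proj X == 0) = (X \in balancing).
Proof.
rewrite -val_eqE /= subr_eq0; apply/eqP/idP => [-> | XK].
  exact: memv_proj.
by rewrite projv_id.
Qed.

Lemma tensor_projK t : tensor_proj (vsval t) = t.
Proof.
apply: val_inj; rewrite /=.
have /eqP-> : projv balancing (vsval t) == 0.
  by rewrite -memv_ker lker_proj subvsP.
by rewrite subr0.
Qed.

Lemma tens_balanced : balanced_map tens.
Proof.
have [hl hr] := bilinear_mapE tens_bilinear.
pose d m b n := tens (ract M b m) n - tens m (lact N b n).
have dl b n : linear (fun m => d m b n).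
  by move=> c m m'; rewrite /d linearP !hl scalerBr opprD addrACA.
have dm m n : linear (fun b => d m b n).
  move=> c b b'; rewrite /d !linearP !lfun_simp hl hr.
  by rewrite scalerBr opprD addrACA.
have dr m b : linear (d m b).
  by move=> c n n'; rewrite /d linearP !hr scalerBr opprD addrACA.
move=> m b n; apply/eqP; rewrite -subr_eq0; apply/eqP.
apply: (linear_basis0 (dl b n)) => {}m Mm.
apply: (linear_basis0 (dm m n)) => {}b Bb.
apply: (linear_basis0 (dr m b)) => {}n Nn.
rewrite /d -linearB /=; apply/eqP; rewrite tensor_proj_eq0 /balancing.
rewrite (big_rem m) //= (big_rem b) //= (big_rem n) //=.
apply: subvP (memv_line _).
by do 2!(apply: subv_trans (addvSl _ _)); apply: addvSl.
Qed.

Lemma tensor_liftE (W : vectType k) (h : M -> N -> W) m n :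
  bilinear_map h -> balanced_map h -> tensor_lift h (tens m n) = h m n.
Proof.
move=> h_lin h_bal; rewrite /tensor_lift /= linearB /= outer_liftE //.
suff /subvP/(_ _ (memv_proj balancing (outer m n))) :
    (balancing <= lker (linfun (outer_lift h)))%VS.
  by rewrite memv_ker lfunE /= => /eqP ->; rewrite subr0.
have sum_sub I (r : seq I) F (U : {vspace _}) :
    (forall i, (F i <= U)%VS) -> (\sum_(i <- r) F i <= U)%VS.
  by move=> FU; elim/big_rec: _ => [|i V _ VU]; rewrite ?sub0v // subv_add FU.
do 3![apply/sum_sub => ?].
by rewrite -memvE memv_ker lfunE /= linearB /= !outer_liftE // h_bal subrr.
Qed.

Lemma tensor_ext (W : lmodType k) (f g : {linear tensor_space -> W}) :
  (forall m n, f (tens m n) = g (tens m n)) -> f =1 g.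
Proof.
move=> fg t; rewrite -(tensor_projK t).
exact: (@outer_ext _ _ _ _ (f \o tensor_proj) (g \o tensor_proj)).
Qed.

Definition tensor_lact a : 'End(tensor_space) :=
  linfun (tensor_lift (fun m n => tens (lact M a m) n)).
Definition tensor_ract c : 'End(tensor_space) :=
  linfun (tensor_lift (fun m n => tens m (ract N c n))).

Lemma tensor_lactE a m n : tensor_lact a (tens m n) = tens (lact M a m) n.
Proof.
have [hl hr] := bilinear_mapE tens_bilinear.
rewrite lfunE /= tensor_liftE //.
  by split=> [? ? ? ?|? ? ? ?]; rewrite ?linearP ?hl ?hr.
by move=> m' b n'; rewrite lractE tens_balanced.
Qed.

Lemma tensor_ractE c m n : tensor_ract c (tens m n) = tens m (ract N c n).
Proof.
have [hl hr] := bilinear_mapE tens_bilinear.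
rewrite lfunE /= tensor_liftE //.
  by split=> [? ? ? ?|? ? ? ?]; rewrite ?linearP ?hl ?hr.
by move=> m' b n'; rewrite tens_balanced lractE.
Qed.

Lemma tensor_lfunP (W : vectType k) (f g : 'Hom(tensor_space, W)) :
  (forall m n, f (tens m n) = g (tens m n)) -> f = g.
Proof. by move=> fg; apply/lfunP; apply: tensor_ext. Qed.

Fact tensor_lact_linear : linear tensor_lact.
Proof.
move=> c a a'; apply: tensor_lfunP => m n.
rewrite add_lfunE scale_lfunE !tensor_lactE.
by rewrite linearP !lfun_simp (bilinear_mapE tens_bilinear).
Qed.
HB.instance Definition _ :=
  GRing.isLinear.Build k A 'End(tensor_space) _ tensor_lact tensor_lact_linear.

Fact tensor_ract_linear : linear tensor_ract.
Proof.
move=> c a a'; apply: tensor_lfunP => m n.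
rewrite add_lfunE scale_lfunE !tensor_ractE.
by rewrite linearP !lfun_simp (bilinear_mapE tens_bilinear).
Qed.
HB.instance Definition _ :=
  GRing.isLinear.Build k C 'End(tensor_space) _ tensor_ract tensor_ract_linear.

Fact tensor_lact1 : tensor_lact 1 = \1%VF.
Proof. by apply: tensor_lfunP => m n; rewrite tensor_lactE lact1 !id_lfunE. Qed.
Fact tensor_lactM a a' :
  tensor_lact (a * a') = (tensor_lact a \o tensor_lact a')%VF.
Proof.
apply: tensor_lfunP => m n.
by rewrite comp_lfunE !tensor_lactE lactM comp_lfunE.
Qed.
Fact tensor_ract1 : tensor_ract 1 = \1%VF.
Proof. by apply: tensor_lfunP => m n; rewrite tensor_ractE ract1 !id_lfunE. Qed.
Fact tensor_ractM c c' :
  tensor_ract (c * c') = (tensor_ract c' \o tensor_ract c)%VF.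
Proof.
apply: tensor_lfunP => m n.
by rewrite comp_lfunE !tensor_ractE ractM comp_lfunE.
Qed.
Fact tensor_lract a c :
  (tensor_lact a \o tensor_ract c = tensor_ract c \o tensor_lact a)%VF.
Proof.
apply: tensor_lfunP => m n.
rewrite !comp_lfunE (tensor_ractE c m n) (tensor_lactE a m n).
by rewrite (tensor_lactE a m (ract N c n)) (tensor_ractE c (lact M a m) n).
Qed.

Definition tensor : bimod A C :=
  Bimod tensor_lact1 tensor_lactM tensor_ract1 tensor_ractM tensor_lract.

End Tensor.

Definition separably_divides (k : fieldType) (A B : falgType k) : Prop :=
  exists (M : bimod A B) (N : bimod B A),
    [/\ left_right_projective M, left_right_projective N
      & direct_summand (regular_bimod A) (tensor M N)].

Record quiver := Quiver {
  vertex : finType;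
  arrow : finType;
  src : arrow -> vertex;
  tgt : arrow -> vertex
}.

Section Paths.
Variable Q : quiver.

Fixpoint walk (x : vertex Q) (s : seq (arrow Q)) : bool :=
  if s is a :: s' then (src a == x) && walk (tgt a) s' else true.

Definition walk_end (x : vertex Q) (s : seq (arrow Q)) : vertex Q :=
  last x (map (@tgt Q) s).

(* A path is its starting vertex and its arrows, in order of traversal; the
   trivial path at [x] is [(x, [::])]. *)
Record qpath := QPath {
  qpath_val : vertex Q * seq (arrow Q);
  _ : walk qpath_val.1 qpath_val.2
}.
HB.instance Definition _ := [isSub for qpath_val].
HB.instance Definition _ := [Choice of qpath by <:].

Definition path_start (p : qpath) := (val p).1.
Definition path_arrows (p : qpath) := (val p).2.
Definition path_end (p : qpath) := walk_end (val p).1 (val p).2.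

Definition trivial_path (x : vertex Q) : qpath := @QPath (x, [::]) isT.

Fact arrow_path_subproof (a : arrow Q) : walk (src a) [:: a].
Proof. by rewrite /= eqxx. Qed.
Definition arrow_path (a : arrow Q) : qpath :=
  @QPath (src a, [:: a]) (arrow_path_subproof a).

(* Only meaningful when [path_end p = path_start q]. *)
Definition path_cat (p q : qpath) : qpath :=
  insubd p (path_start p, path_arrows p ++ path_arrows q).

Definition acyclic : Prop :=
  forall p : qpath, path_start p = path_end p -> path_arrows p = [::].

Lemma walk_cat x s t : walk x (s ++ t) = walk x s && walk (walk_end x s) t.
Proof. by elim: s x => [|a s IHs] x //=; rewrite IHs andbA. Qed.

Lemma path_catE p q : path_end p = path_start q ->
  val (path_cat p q) = (path_start p, path_arrows p ++ path_arrows q).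
Proof.
move=> pq; rewrite /path_cat val_insubd /= walk_cat.
by rewrite -/(path_end p) pq (valP p) (valP q).
Qed.

Lemma path_start_cat p q :
  path_end p = path_start q -> path_start (path_cat p q) = path_start p.
Proof. by move=> pq; rewrite {1}/path_start path_catE. Qed.

Lemma path_end_cat p q :
  path_end p = path_start q -> path_end (path_cat p q) = path_end q.
Proof.
move=> pq; rewrite {1}/path_end path_catE //= /walk_end map_cat last_cat.
by move: pq; rewrite /path_end /walk_end /path_arrows /path_start /= => ->.
Qed.

Lemma path_catA p q r :
  path_end p = path_start q -> path_end q = path_start r ->
  path_cat p (path_cat q r) = path_cat (path_cat p q) r.
Proof.
move=> pq qr; apply: val_inj.
rewrite !path_catE ?path_start_cat ?path_end_cat //.
by rewrite /path_arrows !path_catE //= catA.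
Qed.

End Paths.

(* [p * q] runs through [p] first, then [q]. *)
Definition basis_mul (k : fieldType) (Q : quiver) (p q : qpath Q) :
    {malg k[qpath Q]} :=
  if path_end p == path_start q then << path_cat p q >> else 0.

HB.lock Definition path_mul (k : fieldType) (Q : quiver)
    (f g : {malg k[qpath Q]}) : {malg k[qpath Q]} :=
  \sum_(p <- msupp f) \sum_(q <- msupp g) (f@_p * g@_q) *: basis_mul k p q.
Arguments path_mul {k Q} f g.

Section PathAlgebra.
Variables (k : fieldType) (Q : quiver).
Notation kQ := {malg k[qpath Q]}.
Implicit Types (p q r : qpath Q) (f g h : kQ).
Notation basis_mul := (basis_mul k).

Definition path_one : kQ := \sum_(x : vertex Q) << trivial_path x >>.


Lemma path_mulE (d1 d2 : {fset qpath Q}) (f g : kQ) :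
  (msupp f `<=` d1)%fset -> (msupp g `<=` d2)%fset ->
  path_mul f g = \sum_(p <- d1) \sum_(q <- d2) (f@_p * g@_q) *: basis_mul p q.
Proof.
move=> fd1 gd2; rewrite path_mul.unlock (big_fset_incl _ fd1) /=.
  apply: eq_bigr => p _; apply: big_fset_incl => // q _ /mcoeff_outdom ->.
  by rewrite mulr0 scale0r.
move=> p _ /mcoeff_outdom fp0.
by rewrite big1 // => q _; rewrite fp0 mul0r scale0r.
Qed.

Fact path_mulDl : left_distributive (@path_mul k Q) +%R.
Proof.
move=> f1 f2 g; pose d := (msupp f1 `|` msupp f2)%fset.
rewrite (path_mulE (msuppD_le f1 f2) (fsubset_refl _)).
rewrite (@path_mulE d (msupp g) f1) ?fsubsetUl //.
rewrite (@path_mulE d (msupp g) f2) ?fsubsetUr //.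
rewrite -big_split; apply: eq_bigr => p _; rewrite -big_split.
by apply: eq_bigr => q _; rewrite mcoeffD mulrDl scalerDl.
Qed.

Fact path_mulDr : right_distributive (@path_mul k Q) +%R.
Proof.
move=> f g1 g2; pose d := (msupp g1 `|` msupp g2)%fset.
rewrite (path_mulE (fsubset_refl _) (msuppD_le g1 g2)).
rewrite (@path_mulE (msupp f) d f g1) ?fsubsetUl //.
rewrite (@path_mulE (msupp f) d f g2) ?fsubsetUr //.
rewrite -big_split; apply: eq_bigr => p _; rewrite -big_split.
by apply: eq_bigr => q _; rewrite mcoeffD mulrDr scalerDl.
Qed.

Lemma path_mulZl c f g : path_mul (c *: f) g = c *: path_mul f g.
Proof.
rewrite (path_mulE (msuppZ_le c f) (fsubset_refl _)) path_mul.unlock.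
rewrite scaler_sumr.
apply: eq_bigr => p _; rewrite scaler_sumr; apply: eq_bigr => q _.
by rewrite mcoeffZ scalerA mulrA.
Qed.

Lemma path_mulZr c f g : path_mul f (c *: g) = c *: path_mul f g.
Proof.
rewrite (path_mulE (fsubset_refl _) (msuppZ_le c g)) path_mul.unlock.
rewrite scaler_sumr.
apply: eq_bigr => p _; rewrite scaler_sumr; apply: eq_bigr => q _.
by rewrite mcoeffZ scalerA mulrCA.
Qed.

Lemma path_mulUU p q : path_mul << p >> << q >> = basis_mul p q.
Proof.
rewrite (path_mulE msuppU_le msuppU_le) !big_seq_fset1 !mcoeffUU.
by rewrite mulr1 scale1r.
Qed.

Lemma path_mul_linearl g : linear (path_mul^~ g).
Proof. by move=> c f f'; rewrite path_mulDl path_mulZl. Qed.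

Lemma path_mul_linearr f : linear (path_mul f).
Proof. by move=> c g g'; rewrite path_mulDr path_mulZr. Qed.

Lemma path_ext (F G : kQ -> kQ) : linear F -> linear G ->
  (forall p, F << p >> = G << p >>) -> F =1 G.
Proof.
move=> Flin Glin FG f.
have F0 : F 0 = 0.
  by have := Flin (-1) 0 0; rewrite scaler0 addr0 scaleN1r addNr.
have G0 : G 0 = 0.
  by have := Glin (-1) 0 0; rewrite scaler0 addr0 scaleN1r addNr.
rewrite (monalgE f); elim/big_rec: _ => [|p g _ Fg]; first by rewrite F0 G0.
suff -> : << f@_p *g p >> = f@_p *: << p >> by rewrite Flin Glin FG Fg.
apply/malgP => q; move: (f@_p) => c.
by rewrite [RHS]mcoeffZ [LHS]mcoeffU mcoeffU mulrnAr mulr1.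
Qed.

Fact path_mul0l f : path_mul 0 f = 0.
Proof. by have := path_mulZl 0 0 f; rewrite !scale0r. Qed.
Fact path_mul0r f : path_mul f 0 = 0.
Proof. by have := path_mulZr 0 f 0; rewrite !scale0r. Qed.

Fact path_mulA : associative (@path_mul k Q).
Proof.
pose L f g h := path_mul f (path_mul g h).
pose R f g h := path_mul (path_mul f g) h.
have L1 g h : linear (fun f => L f g h) by exact: path_mul_linearl.
have L2 f h : linear (fun g => L f g h).
  by move=> c g g'; rewrite /L path_mul_linearl path_mul_linearr.
have L3 f g : linear (L f g).
  by move=> c h h'; rewrite /L !path_mul_linearr.
have R1 g h : linear (fun f => R f g h).
  by move=> c f f'; rewrite /R !path_mul_linearl.
have R2 f h : linear (fun g => R f g h).
  by move=> c g g'; rewrite /R path_mul_linearr path_mul_linearl.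
have R3 f g : linear (R f g) by exact: path_mul_linearr.
move=> f g h; apply: (path_ext (L1 g h) (R1 g h)) => p.
apply: (path_ext (L2 _ h) (R2 _ h)) => q.
apply: (path_ext (L3 _ _) (R3 _ _)) => r.
have -> : L << p >> << q >> << r >> = path_mul << p >> (basis_mul q r).
  by congr (path_mul _ _); exact: path_mulUU.
have -> : R << p >> << q >> << r >> = path_mul (basis_mul p q) << r >>.
  by congr (path_mul _ _); exact: path_mulUU.
rewrite /basis_mul.
have [qr|qr] := eqVneq (path_end q) (path_start r); last first.
  rewrite path_mul0r; have [pq|pq] := eqVneq; last by rewrite path_mul0l.
  by rewrite path_mulUU /basis_mul path_end_cat // (negPf qr).
rewrite path_mulUU /basis_mul path_start_cat //.
have [pq|pq] := eqVneq; last by rewrite path_mul0l.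
by rewrite path_mulUU /basis_mul path_end_cat // qr eqxx path_catA.
Qed.

Fact path_mul1l : left_id path_one (@path_mul k Q).
Proof.
apply: path_ext => [|//|p]; first exact: path_mul_linearr.
rewrite /path_one.
rewrite (big_morph (path_mul^~ _) (fun _ _ => path_mulDl _ _ _) (path_mul0l _)).
rewrite (bigD1 (path_start p)) //= big1 ?addr0 => [|x /negPf nx].
  rewrite path_mulUU /basis_mul eqxx; congr (<< _ >>); apply: val_inj.
  by rewrite path_catE //= [RHS]surjective_pairing.
by rewrite path_mulUU /basis_mul /path_end /walk_end /= nx.
Qed.

Fact path_mul1r : right_id path_one (@path_mul k Q).
Proof.
apply: path_ext => [|//|p]; first exact: path_mul_linearl.
rewrite /path_one.
rewrite (big_morph (path_mul _) (fun _ _ => path_mulDr _ _ _) (path_mul0r _)).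
rewrite (bigD1 (path_end p)) //= big1 ?addr0 => [|x /negPf nx].
  rewrite path_mulUU /basis_mul eqxx; congr (<< _ >>); apply: val_inj.
  by rewrite path_catE //= /path_start /path_arrows cats0 -surjective_pairing.
by rewrite path_mulUU /basis_mul /path_start /= eq_sym nx.
Qed.

(* Finitely supported functions from paths to [k], with basis the
   [<< p >>]. *)
Definition path_algebra : Type := kQ.
HB.instance Definition _ := GRing.Lmodule.on path_algebra.
HB.instance Definition _ := GRing.Zmodule_isPzRing.Build path_algebra
  path_mulA path_mul1l path_mul1r path_mulDl path_mulDr.

End PathAlgebra.

Section Ideals.
Variable R : pzRingType.

Definition two_sided_ideal (I : R -> Prop) : Prop :=
  [/\ I 0, forall x y, I x -> I y -> I (x + y)
    & forall a x b, I x -> I (a * x * b)].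

Definition ideal_generated (S : R -> Prop) : R -> Prop := fun x =>
  forall I, two_sided_ideal I -> (forall y, S y -> I y) -> I x.

Definition ideal_power (J : R -> Prop) (m : nat) : R -> Prop :=
  ideal_generated (fun x =>
    exists2 t : 'I_m -> R, forall i, J (t i) & x = \prod_(i < m) t i).

End Ideals.

Section Directed.
Variable k : fieldType.

Definition arrow_ideal (Q : quiver) : path_algebra k Q -> Prop :=
  ideal_generated (fun x : path_algebra k Q =>
    exists a : arrow Q, x = << arrow_path a >>).

Definition admissible (Q : quiver) (I : path_algebra k Q -> Prop) : Prop :=
  [/\ two_sided_ideal I,
      exists2 m, (2 <= m)%N
        & forall x, ideal_power (@arrow_ideal Q) m x -> I x
    & forall x, I x -> ideal_power (@arrow_ideal Q) 2 x].

(* [A] is isomorphic to [kQ / I]. *)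
Definition quotient_of (Q : quiver) (I : path_algebra k Q -> Prop)
    (A : falgType k) : Prop :=
  exists f : {linear path_algebra k Q -> A},
    [/\ monoid_morphism f, forall a, exists x, f x = a
      & forall x, I x <-> f x = 0].

Definition directed (A : falgType k) : Prop :=
  exists (Q : quiver) (I : path_algebra k Q -> Prop),
    [/\ acyclic Q, admissible I & quotient_of I A].

End Directed.

(* Main.v *)
Require Import Defs.
From HB Require Import structures.
From mathcomp Require Import all_boot all_algebra all_field.
From mathcomp Require Import finmap monalg boolp.

(** The two halves have different reasons, but both run through one fact: over a
    self-injective algebra a left-projective bimodule is also left injective
    ([left_injective]), so that every injection of it into a module splits.
    A separable division of [A] by [B] through [M] and [N] is used in the form
    of an element [w] of the tensor product with [a w = w a] and a bimodule map
    [p] back to the algebra with [p w = 1] ([separating_element]): for every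
    module [X] it exhibits [X] as a natural direct summand of its image under
    the composite tensor functor.  A splitting of the image of an injection can
    therefore be pulled back to a splitting of the injection itself.

    Directedness enters through triangularity ([directed_triangular]): the
    vertices give orthogonal idempotents [e x] with sum [1], ranked by [h], such
    that [e x * A * e x] is spanned by [e x] and [e x * A * e y] vanishes for
    [x != y] unless [h x < h y].

    If [A] is such and not semisimple, a source [x] with some nonzero [a] in
    [e x * A * e y], [y != x], gives an injection of the projective module
    [A * e x], which is spanned by [e x], into [A], by right multiplication by
    [a] ([exists_source_arrow]).  It does not split.  After tensoring with [N]
    it becomes an injection of [N * e x] into [N], which splits because [N] is
    injective over [B].  If [A] divides [B], this splitting descends, a
    contradiction ([no_source_arrow]).

    If [B] divides [A], with [M] the [B]-[A]-bimodule, then tensoring with [M]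
    sends every finite-dimensional [A]-module to a projective [B]-module.  This is a devissage:
    by triangularity every module has a projective presentation whose syzygy
    lives on vertices of smaller rank ([syzygy_supported]), and the image of a
    syzygy that is injective over [B] splits off.  In [induced_summand] this is
    carried out for submodules [K] of finite free modules, the statement being
    that [M K] is a direct summand of the corresponding power of [M].  Applied
    to the preimage of a submodule of [N] determined by a left ideal [U] of
    [B], it yields a splitting of the inclusion of [U] in [B], that is, an
    element [u] of [U] with [b * u = b] on [U] ([left_ideal_right_unit]).  An
    algebra all of whose left ideals split off is semisimple
    ([semisimple_of_right_units]). *)

Set Implicit Arguments.
Unset Strict Implicit.
Unset Printing Implicit Defensive.

Import GRing.Theory.
Local Open Scope ring_scope.

(** * Injective modules and dual bases *)

Section LinearExtension.
Variables (R : pzRingType) (X Y : lmodType R) (u : {linear X -> Y}).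

Definition image_pred : {pred Y} := fun y => `[< exists x, u x = y >].

Fact image_pred_closed : submod_closed image_pred.
Proof.
split=> [|c y y' /asboolP[x <-] /asboolP[x' <-]]; apply/asboolP.
  by exists 0; rewrite linear0.
by exists (c *: x + x'); rewrite linearP.
Qed.
HB.instance Definition _ :=
  GRing.isSubmodClosed.Build R Y image_pred image_pred_closed.

Record image_submodule := ImageSubmodule {
  image_val : Y;
  _ : image_val \in image_pred
}.
HB.instance Definition _ := [isSub for image_val].
HB.instance Definition _ := [Choice of image_submodule by <:].
HB.instance Definition _ := [SubChoice_isSubLmodule of image_submodule by <:].

(** The form in which injectivity is applied: extend along the inclusion of the
    image of [u] the map that [f] induces on that image. *)
Lemma injective_ext (E : lmodType R) (f : {linear X -> E}) :
  injective_module E -> (forall x, u x = 0 -> f x = 0) ->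
  exists r : {linear Y -> E}, forall x, r (u x) = f x.
Proof.
move=> E_inj uf0.
have uf x x' : u x = u x' -> f x = f x'.
  move=> uxx'; apply/eqP; rewrite -subr_eq0 -linearB uf0 // linearB uxx'.
  exact: subrr.
have pre (y : image_submodule) : {x | u x = val y}.
  by apply: cid; apply/asboolP; exact: (valP y).
pose h y := f (sval (pre y)).
have h_lin : linear h.
  move=> c y y'; rewrite /h -linearP; apply: uf.
  by rewrite linearP !(svalP (pre _)) linearP.
pose hL : {linear image_submodule -> E} :=
  HB.pack h (GRing.isLinear.Build _ _ _ _ h h_lin).
have [r rE] := E_inj _ Y (val : {linear image_submodule -> Y}) hL val_inj.
exists r => x.
have ux : u x \in image_pred by apply/asboolP; exists x.
rewrite -[u x]/(val (ImageSubmodule ux)) rE.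
by apply: uf; rewrite (svalP (pre _)).
Qed.

End LinearExtension.

Lemma ffun_injective (R : pzRingType) (E : lmodType R) (T : finType) :
  injective_module E -> injective_module ({ffun T -> E} : lmodType R).
Proof.
move=> E_inj X Y g f g_inj.
have /choice[r rE] t : exists r : {linear Y -> E}, forall x, r (g x) = f x t.
  have ft_lin : linear (fun x => f x t).
    by move=> c x y; rewrite linearP !ffunE.
  pose ft : {linear X -> E} :=
    HB.pack (fun x => f x t) (GRing.isLinear.Build _ _ _ _ _ ft_lin).
  by have [r rE] := E_inj _ _ g ft g_inj; exists r.
pose h y := [ffun t => r t y].
have h_lin : linear h.
  by move=> c y y'; apply/ffunP => t; rewrite !ffunE linearP.
pose hL : {linear Y -> {ffun T -> E}} :=
  HB.pack h (GRing.isLinear.Build _ _ _ _ h h_lin).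
by exists hL => x; apply/ffunP => t; rewrite ffunE rE.
Qed.

(** Split the surjection from a free module given by the generators [v], and
    read off the coordinates of the section. *)
Lemma dual_basis (R : nzRingType) (P : lmodType R) n (v : 'I_n -> P) :
    projective_module P -> (forall x, exists c, x = \sum_i c i *: v i) ->
  exists phi : 'I_n -> {linear P -> R^o}, forall x, x = \sum_i phi i x *: v i.
Proof.
move=> P_proj v_gen.
pose comb (c : {ffun 'I_n -> R^o}) : P := \sum_i (c i : R) *: v i.
have comb_lin : linear comb.
  move=> a c c'; rewrite /comb scaler_sumr -big_split; apply: eq_bigr => i _.
  by rewrite !ffunE scalerDl scalerA.
pose combL : {linear _ -> P} :=
  HB.pack comb (GRing.isLinear.Build _ _ _ _ comb comb_lin).
have comb_surj x : exists c, combL c = x.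
  have [c ->] := v_gen x; exists (finfun c).
  by apply: eq_bigr => i _; rewrite ffunE.
have [h hE] := P_proj _ _ combL idfun comb_surj.
have h_lin i : linear (fun p => h p i).
  by move=> a p p'; rewrite linearP !ffunE.
pose phi i : {linear P -> R^o} := HB.pack (fun p => h p i)
  (GRing.isLinear.Build _ _ _ _ (fun p => h p i) (h_lin i)).
exists phi => x.
by rewrite -[LHS](hE x).
Qed.

Section BimoduleDualBases.
Variables (k : fieldType) (A B : falgType k) (X : bimod A B).

Lemma lact_algC c x : lact X c%:A x = c *: x.
Proof. by rewrite linearZ lact1 !lfun_simp. Qed.

Lemma ract_algC c x : ract X c%:A x = c *: x.
Proof. by rewrite linearZ ract1 !lfun_simp. Qed.

(** A dual basis makes a projective module a retract of a power of the regular
    module, so it inherits the injectivity of the latter. *)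
Lemma left_injective :
  projective_module (left_module X : lmodType A) -> self_injective A ->
  injective_module (left_module X : lmodType A).
Proof.
move=> X_proj A_inj.
have gen (x : left_module X) :
    exists c : 'I_(\dim {:X}) -> A,
      x = \sum_i c i *: ((vbasis {:X})`_i : left_module X).
  exists (fun i => (coord (vbasis {:X}) i x)%:A).
  rewrite [LHS](coord_vbasis (memvf (x : X))); apply: eq_bigr => i _.
  exact/esym/lact_algC.
have [phi phiE] := dual_basis X_proj gen.
move=> Y Z g f g_inj.
have /choice[r rE] i : exists r : {linear Z -> A^o},
    forall y, r (g y) = (phi i \o f) y by exact: A_inj.
pose h z : left_module X :=
  \sum_i (r i z : A) *: ((vbasis {:X})`_i : left_module X).
have h_lin : linear h.
  move=> a z z'; rewrite /h scaler_sumr -big_split; apply: eq_bigr => i _.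
  by rewrite linearP scalerDl scalerA.
pose hL : {linear Z -> left_module X} :=
  HB.pack h (GRing.isLinear.Build _ _ _ _ h h_lin).
exists hL => y /=.
by rewrite [RHS]phiE; apply: eq_bigr => i _; rewrite rE.
Qed.

(** Right flatness enters only through these coordinates: for a submodule [K] of
    a free left module over [B], they decide which vectors over [X] lie in
    [X K] (see [induced]). *)
Lemma right_dual_basis :
  projective_module (right_module X : lmodType B^c) ->
  exists phi : 'I_(\dim {:X}) -> {linear X -> B},
    (forall i b x, phi i (ract X b x) = phi i x * b) /\
    (forall x, x = \sum_i ract X (phi i x) (vbasis {:X})`_i).
Proof.
move=> X_proj.
have gen (x : right_module X) :
    exists c : 'I_(\dim {:X}) -> B^c,
      x = \sum_i c i *: ((vbasis {:X})`_i : right_module X).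
  exists (fun i => (coord (vbasis {:X}) i x)%:A : B).
  rewrite [LHS](coord_vbasis (memvf (x : X))); apply: eq_bigr => i _.
  exact/esym/ract_algC.
have [phi phiE] := dual_basis X_proj gen.
have phiM i b (x : X) : phi i (ract X b x) = (phi i x : B) * b :> B.
  exact: (linearZ_LR (phi i) (b : B^c) x).
have phi_lin i : linear (phi i : X -> B).
  move=> c x y; rewrite -mulr_algr -phiM ract_algC.
  exact: (raddfD (phi i)).
pose psi i : {linear X -> B} := HB.pack (phi i : X -> B)
  (GRing.isLinear.Build k X B _ (phi i : X -> B) (phi_lin i)).
by exists psi.
Qed.

End BimoduleDualBases.

(** * A criterion for semisimplicity *)

Section SemisimpleCriterion.
Variables (k : fieldType) (A : falgType k).
Implicit Types U V : {vspace A}.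

Lemma left_idealP U :
  reflect (forall a x, x \in U -> a * x \in U) (left_ideal U).
Proof.
apply: (iffP prodvP) => [UU a x | UU a x _]; last exact: UU.
by apply: UU; apply: memvf.
Qed.

Lemma exists_simple_left_ideal V : left_ideal V -> V != 0%VS ->
  exists2 U, simple_left_ideal U & (U <= V)%VS.
Proof.
have [d] := ubnP (\dim V); elim: d V => // d IHd V dimV V_left V_neq0.
have [V_simple|V_nsimple] := pselect (simple_left_ideal V).
  by exists V.
have [W [W_left WV W_neq0 W_neqV]] : exists W,
    [/\ left_ideal W, (W <= V)%VS, W != 0%VS & W != V].
  apply: contrapT => noW; apply: V_nsimple; split=> // W W_left WV.
  have [->|W_neq0] := eqVneq W 0%VS; first by left.
  have [->|W_neqV] := eqVneq W V; first by right.
  by case: noW; exists W.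
have dimW : (\dim W < d)%N.
  apply: (@leq_trans (\dim V)) => //; rewrite ltn_neqAle dimvS // andbT.
  by apply: contra W_neqV => dimWV; rewrite eqEdim WV (eqP dimWV) leqnn.
have [U U_simple UW] := IHd W dimW W_left W_neq0.
by exists U => //; apply: subv_trans WV.
Qed.

(** Right multiplication by [u] is a projection of the algebra onto [U], so a
    simple left ideal [U] inside a left ideal [V] splits off, with complement
    the set of all [x - x * u] for [x] in [V]. *)
Lemma semisimple_of_right_units :
    (forall U, left_ideal U ->
       exists2 u, u \in U & forall x, x \in U -> x * u = x) ->
  semisimple A.
Proof.
move=> unit_of.
suff decomp V : left_ideal V -> exists n (S : 'I_n -> {vspace A}),
    [/\ forall i, simple_left_ideal (S i), (\sum_i S i)%VS = V
      & \sum_i \dim (S i) = \dim V]%N.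
  have [|n [S [S_simple sumS dimS]]] := decomp fullv.
    by apply/left_idealP => *; apply: memvf.
  exists n, S; split=> //; by rewrite directvE /= dimS sumS.
have [d] := ubnP (\dim V); elim: d V => // d IHd V dimV V_left.
have [->|V_neq0] := eqVneq V 0%VS.
  exists 0, (fun=> 0%VS); rewrite !big_ord0 dimv0.
  by split=> // -[].
have [U U_simple UV] := exists_simple_left_ideal V_left V_neq0.
have [U_left U_neq0 _] := U_simple.
have [u uU Uu] := unit_of U U_left.
pose f := (\1 - amulr u)%VF : 'End(A).
have fE x : f x = x - x * u by rewrite !lfun_simp.
pose W := (f @: V)%VS.
have WV : (W <= V)%VS.
  apply/subvP => _ /memv_imgP[x xV ->]; rewrite fE memvB //.
  by move/left_idealP: V_left; apply; apply: (subvP UV).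
have W_left : left_ideal W.
  apply/left_idealP => a _ /memv_imgP[x xV ->]; apply/memv_imgP.
  exists (a * x); first by move/left_idealP: V_left; apply.
  by rewrite !fE mulrBr mulrA.
have UW0 : (U :&: W = 0)%VS.
  apply/eqP; rewrite -subv0; apply/subvP => y /memv_capP[yU].
  case/memv_imgP=> x xV yE; rewrite -(Uu y yU) yE fE mulrBl -mulrA.
  rewrite (Uu u uU) subrr.
  exact: mem0v.
have UWV : (U + W = V)%VS.
  apply/eqP; rewrite eqEsubv subv_add UV WV; apply/subvP => x xV.
  rewrite -(subrK (x * u) x) addrC memv_add //.
    by move/left_idealP: U_left; apply.
  by rewrite -fE memv_img.
have dimUW : (\dim U + \dim W = \dim V)%N by rewrite -dimv_disjoint_sum // UWV.
have [|n [S [S_simple sumS dimS]]] := IHd W _ W_left.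
  have: (0 < \dim U)%N by rewrite lt0n dimv_eq0.
  by move: dimV; rewrite -dimUW; case: (\dim U) => // m; rewrite ltnS => + _;
    apply: leq_trans; rewrite addSn ltnS leq_addl.
exists n.+1, (fun i => oapp S U (unlift ord0 i)).
rewrite !big_ord_recl unlift_none /=.
under eq_bigr do rewrite liftK /=.
under [X in (_ + X)%N]eq_bigr do rewrite liftK /=.
rewrite sumS dimS; split=> // i.
by case: unliftP => [j|] _ /=.
Qed.
End SemisimpleCriterion.

(** * Triangular idempotents of a directed algebra *)

Record triangular_idempotents (k : fieldType) (A : falgType k) (V : finType)
    (e : V -> A) (h : V -> nat) : Prop := TriangularIdempotents {
  idem_sum : \sum_x e x = 1;
  idem_id : forall x, e x * e x = e x;
  idem_orth : forall x y, x != y -> e x * e y = 0;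
  idem_diag : forall x a, exists c : k, e x * a * e x = c *: e x;
  idem_upper : forall x y a, x != y -> (h y <= h x)%N -> e x * a * e y = 0
}.

Section AcyclicRank.
Variable Q : quiver.
Hypothesis Q_acyclic : acyclic Q.

Definition adjacent : rel (vertex Q) :=
  [rel x y | [exists a : arrow Q, (src a == x) && (tgt a == y)]].

Lemma connect_walk x y : connect adjacent x y ->
  exists2 s : seq (arrow Q), walk x s & walk_end x s = y.
Proof.
case/connectP=> p; elim: p x => [|z p IHp] x /=.
  by move=> _ ->; exists [::].
case/andP=> /existsP[a /andP[/eqP <- /eqP <-]] ap yE.
by have [s s_walk sE] := IHp _ ap yE; exists (a :: s) => //=; rewrite eqxx.
Qed.

Lemma walk_connect x s : walk x s -> connect adjacent x (walk_end x s).
Proof.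
elim: s x => [|a s IHs] x /=; first by rewrite connect0.
case/andP=> /eqP <- /IHs; apply: connect_trans; apply: connect1.
by apply/existsP; exists a; rewrite !eqxx.
Qed.

(** Counting predecessors ranks the vertices of an acyclic quiver so that arrows
    increase the rank. *)
Definition rank (x : vertex Q) : nat := #|[pred z | connect adjacent z x]|.

Lemma rank_lt (p : qpath Q) :
  path_arrows p != [::] -> (rank (path_start p) < rank (path_end p))%N.
Proof.
move=> p_neq0; have p_conn := walk_connect (valP p).
apply: proper_card; apply/properP; split.
  by apply/subsetP => z; rewrite !inE => /connect_trans; apply.
exists (path_end p); rewrite !inE ?connect0 //.
apply: contra p_neq0 => /connect_walk[s s_walk sE].
have ps_walk : walk (path_start p) (path_arrows p ++ s).
  by rewrite walk_cat (valP p).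
suff: path_arrows p ++ s = [::] by case: (path_arrows p).
apply: (@Q_acyclic (@QPath Q (_, _) ps_walk)).
by rewrite /path_end /walk_end /= map_cat last_cat; exact/esym/sE.
Qed.

Lemma path_eq_trivial (p : qpath Q) :
  path_start p = path_end p -> p = trivial_path (path_start p).
Proof.
move=> /Q_acyclic p0; apply: val_inj; rewrite /= [LHS]surjective_pairing.
by congr (_, _).
Qed.

End AcyclicRank.

(** The idempotents are the images of the trivial paths, and [e x * A * e y] is
    spanned by the images of the paths from [x] to [y]. *)
Lemma directed_triangular (k : fieldType) (A : falgType k) : directed A ->
  exists (V : finType) (e : V -> A) (h : V -> nat), triangular_idempotents e h.
Proof.
case=> Q [I [Q_acyclic _ [f [f_morph f_surj _]]]].
have [f1 fM] := f_morph.
pose g (p : qpath Q) : A := f (<< p >> : path_algebra k Q).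
have gM p q : g p * g q =
    if path_end p == path_start q then g (path_cat p q) else 0.
  rewrite /g -fM.
  have -> : (<< p >> : path_algebra k Q) * << q >> = basis_mul k p q.
    exact: path_mulUU.
  by rewrite /basis_mul; case: eqP => // _; rewrite linear0.
pose e x := g (trivial_path x).
have eg x p : e x * g p = if x == path_start p then g p else 0.
  rewrite gM /path_end /walk_end /=; case: eqP => // xE; congr g.
  apply: val_inj; rewrite path_catE //= xE.
  by rewrite [RHS]surjective_pairing.
have ge p x : g p * e x = if path_end p == x then g p else 0.
  rewrite gM; case: eqP => // xE; congr g.
  apply: val_inj; rewrite path_catE //= /path_arrows /= cats0.
  by rewrite [RHS]surjective_pairing.
have corner x y (P : A -> Prop) :
    P 0 -> (forall c a b, P a -> P b -> P (c *: a + b)) ->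
    (forall p, path_start p = x -> path_end p = y -> P (g p)) ->
  forall a, P (e x * a * e y).
  move=> P0 P_lin Pg a; have [w <-] := f_surj a.
  rewrite (monalgE w); elim/big_rec: _ => [|p v _ Pv].
    by rewrite linear0 mulr0 mul0r.
  have -> : << w@_p *g p >> = w@_p *: << p >> :> path_algebra k Q.
    apply/malgP => q; move: (w@_p) => c.
    by rewrite [RHS]mcoeffZ [LHS]mcoeffU mcoeffU mulrnAr mulr1.
  rewrite linearP mulrDr mulrDl -scalerAr -scalerAl; apply: P_lin => //.
  rewrite -/(g p) eg; case: eqP => [xE|_]; last by rewrite mul0r.
  by rewrite ge; case: eqP => [yE|_] //; apply: Pg.
exists (vertex Q), e, (@rank Q); split.
- by rewrite -f1 [1 in RHS]/(path_one k Q) linear_sum.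
- by move=> x; rewrite eg eqxx.
- by move=> x y /negPf xy; rewrite eg /path_start /= xy.
- move=> x a; pattern (e x * a * e x).
  apply: corner => [|c _ _ [c1 ->] [c2 ->]|p px py].
  + by exists 0; rewrite scale0r.
  + by exists (c * c1 + c2); rewrite scalerDl scalerA.
  exists 1; rewrite scale1r /e -px -path_eq_trivial // px //.
- move=> x y a xy yx; pattern (e x * a * e y).
  apply: corner => [//|c _ _ -> ->|p px py]; first by rewrite scaler0 addr0.
  have p_neq0 : path_arrows p != [::].
    apply: contra xy => /eqP p0; rewrite -px -py.
    by rewrite /path_end /walk_end -/(path_arrows p) p0.
  by have := rank_lt Q_acyclic p_neq0; rewrite px py ltnNge yx.
Qed.

Section Triangular.
Variables (k : fieldType) (A : falgType k) (V : finType).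
Variables (e : V -> A) (h : V -> nat).
Hypothesis e_tri : triangular_idempotents e h.

Lemma peirce_left a : a = \sum_x e x * a.
Proof. by rewrite -mulr_suml (idem_sum e_tri) mul1r. Qed.

Lemma peirce_right a : a = \sum_x a * e x.
Proof. by rewrite -mulr_sumr (idem_sum e_tri) mulr1. Qed.

(** Every left ideal is spanned by the [e x] that it contains; their sum is its
    right unit. *)
Lemma diagonal_semisimple :
  (forall x y a, x != y -> e x * a * e y = 0) -> semisimple A.
Proof.
move=> off0; apply: semisimple_of_right_units => U /left_idealP U_left.
exists (\sum_(x | e x \in U) e x) => [|b bU]; first exact: memv_suml.
rewrite [RHS]peirce_right [RHS](bigID (fun x => e x \in U)) /= mulr_sumr.
rewrite [X in _ + X]big1 ?addr0 // => x xU.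
have bex : b * e x = e x * b * e x.
  rewrite {1}[b * e x]peirce_left (bigD1 x) //= big1 => [|y yx].
    by rewrite addr0 mulrA.
  by rewrite mulrA off0.
have exb : e x * b = e x * b * e x.
  rewrite {1}[e x * b]peirce_right (bigD1 x) //= big1 ?addr0 // => y yx.
  by rewrite off0 // eq_sym.
have [c cE] := idem_diag e_tri x b; rewrite bex cE.
have [->|c_neq0] := eqVneq c 0; first by rewrite scale0r.
case/negP: xU; have := U_left (e x) b bU; rewrite exb cE.
by rewrite rpredZeq (negPf c_neq0).
Qed.

(** If the algebra is not diagonal, take [x] of least rank such that
    [e x * A * e y] is nonzero for some [y != x]; then nothing enters [x], so
    that [s = e x] spans [A * s]. *)
Lemma exists_source_arrow : ~ semisimple A ->
  exists s a : A, [/\ forall x, exists c : k, x * s = c *: s,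
    s * s = s, s * a = a, a * s = 0 & a != 0].
Proof.
move=> A_nss; apply: contrapT => no_arrow; apply: A_nss.
apply: diagonal_semisimple => x; have [n] := ubnP (h x).
elim: n x => // n IHn x hx y a xy; apply/eqP; apply: contrapT => /negP b_neq0.
apply: no_arrow; exists (e x), (e x * a * e y); split=> // [z|||].
- rewrite [z * e x]peirce_left (bigD1 x) //= big1 => [|w wx].
    by rewrite addr0 mulrA; apply: (idem_diag e_tri).
  rewrite mulrA; have [hxw|hwx] := leqP (h x) (h w).
    by rewrite (idem_upper e_tri).
  by apply: IHn => //; rewrite -ltnS; apply: (leq_trans _ hx).
- exact: (idem_id e_tri).
- by rewrite !mulrA (idem_id e_tri).
- by rewrite -mulrA (idem_orth e_tri) ?mulr0 // eq_sym.
Qed.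

End Triangular.

(** * Separable division *)

Section SeparatingElement.
Variables (k : fieldType) (A B : falgType k) (M : bimod A B) (N : bimod B A).

Lemma dsum_lactE (X Y : bimod A A) a z :
  lact (dsum X Y) a z = (lact X a z.1, lact Y a z.2).
Proof. exact: lfunE. Qed.

Lemma dsum_ractE (X Y : bimod A A) a z :
  ract (dsum X Y) a z = (ract X a z.1, ract Y a z.2).
Proof. exact: lfunE. Qed.

Lemma regular_lactE (a x : A) : lact (regular_bimod A) a x = a * x.
Proof. exact: lfunE. Qed.

Lemma regular_ractE (a x : A) : ract (regular_bimod A) a x = x * a.
Proof. exact: lfunE. Qed.

(** [w] is the image of [1] under the inclusion of the regular bimodule, and [p]
    is the projection onto it. *)
Lemma separating_element :
    direct_summand (regular_bimod A) (tensor M N) ->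
  exists (w : tensor M N) (p : {linear tensor M N -> A}),
  [/\ p w = 1, forall a, lact (tensor M N) a w = ract (tensor M N) a w,
      forall a t, p (lact (tensor M N) a t) = a * p t
    & forall a t, p (ract (tensor M N) a t) = p t * a].
Proof.
case=> Z [f [[f' fK f'K] fl fr]].
have p_lin : linear (fun t => (f t).1 : A) by move=> c t u; rewrite linearP.
pose p : {linear tensor M N -> A} :=
  HB.pack (fun t => (f t).1 : A) (GRing.isLinear.Build k _ A _ _ p_lin).
exists (f' (1, 0)), p; split=> [|a|a t|a t].
- by rewrite /= f'K.
- apply: (can_inj fK); rewrite fl fr f'K dsum_lactE dsum_ractE !linear0.
  by rewrite regular_lactE regular_ractE mulr1 mul1r.
- by rewrite /= fl dsum_lactE regular_lactE.
- by rewrite /= fr dsum_ractE regular_ractE.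
Qed.

End SeparatingElement.

Section LeftModuleMaps.
Variables (k : fieldType) (A B C : falgType k).
Variables (X : bimod A B) (Y : bimod A C).

Fact ract_left_linear b :
  linear (ract X b : left_module X -> left_module X).
Proof.
move=> a x y.
have -> : ract X b (a *: x + y) = ract X b (lact X a x) + ract X b y.
  exact: linearD.
by rewrite -lractE.
Qed.

Definition ract_left b : {linear left_module X -> left_module X} :=
  HB.pack (ract X b : left_module X -> left_module X)
    (GRing.isLinear.Build _ _ _ _ _ (ract_left_linear b)).

Lemma left_linear_lact (r : {linear left_module X -> left_module Y}) a (x : X) :
  r (lact X a x) = lact Y a (r x) :> Y.
Proof. exact: (linearZ_LR r a (x : left_module X)). Qed.

Lemma left_linear_base (r : {linear left_module X -> left_module Y}) :
  linear (r : X -> Y).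
Proof.
move=> c x y; rewrite -[c *: x]lact_algC.
by rewrite -[c *: r x]lact_algC -left_linear_lact; apply: (raddfD r).
Qed.

End LeftModuleMaps.

(** * A directed algebra dividing a self-injective one *)

Section DividesSelfInjective.
Variables (k : fieldType) (A B : falgType k) (M : bimod A B) (N : bimod B A).
Hypotheses (N_proj : left_right_projective N) (B_inj : self_injective B).
Hypothesis A_summand : direct_summand (regular_bimod A) (tensor M N).

(** If [a] were nonzero, right multiplication by [a] would embed [A * s] in [A],
    hence [N * s] in [N] by flatness; as [N] is injective over [B] there is a
    left inverse [r] of the latter embedding.  It induces a left [A]-linear map
    [tau] from the tensor product to [A * s], and [tau w] is then an element of
    the line [A * s] with [a * tau w = s], whereas [a] annihilates that line. *)
Lemma no_source_arrow (s a : A) : (forall x, exists c : k, x * s = c *: s) ->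
  s * s = s -> s * a = a -> a * s = 0 -> a = 0.
Proof.
move=> s_source ss sa as0; apply/eqP; apply: contrapT => /negP a_neq0.
have N_inj := left_injective N_proj.1 B_inj.
have [phi [phiM phiE]] := right_dual_basis N_proj.2.
have ker_sub (x : left_module N) : ract_left N a x = 0 -> ract_left N s x = 0.
  move=> /= xa0; rewrite [LHS]phiE big1 // => i _.
  have [c cE] := s_source (phi i x).
  have : phi i (ract N a x) = c *: a.
    by rewrite phiM -{1}sa mulrA cE -scalerAl sa.
  rewrite xa0 linear0 => /esym/eqP; rewrite scaler_eq0 (negPf a_neq0) orbF.
  by move=> /eqP c0; rewrite phiM cE c0 scale0r linear0 lfunE.
have [r rE] := injective_ext N_inj ker_sub.
have [w [p [pw1 w_central pl pr]]] := separating_element A_summand.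
have [tl tr] := bilinear_mapE (tens_bilinear M N).
(* [r] need not take values in [N * s]; multiplying by [s] forces this without
   disturbing [r] on the image of the embedding, as [s * s = s]. *)
pose h m n := p (tens m (ract N s (r n))).
have r_lin := left_linear_base r.
have h_bilin : bilinear_map h.
  split=> [n c m m'|m c n n']; rewrite /h; first by rewrite tl linearP.
  by rewrite r_lin linearP tr linearP.
have h_bal : balanced_map h.
  by move=> m b n; rewrite /h left_linear_lact -lractE tens_balanced.
pose tau : {linear tensor M N -> A} := tensor_lift h.
have tauE m n : tau (tens m n) = h m n by exact: tensor_liftE.
have tau_a t : tau (ract (tensor M N) a t) = p t * s.
  rewrite -pr.
  apply: (tensor_ext (f := tau \o ract (tensor M N) a)
                     (g := p \o ract (tensor M N) s)) => m n /=.
  rewrite !tensor_ractE tauE /h; congr (p (tens _ _)).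
  have rna : r (ract N a n) = ract N s n := rE n.
  by rewrite rna -comp_lfunE -ractM ss.
have tau_l b t : tau (lact (tensor M N) b t) = b * tau t.
  have -> : b * tau t = amull b (tau t) by rewrite lfunE.
  apply: (tensor_ext (f := tau \o lact (tensor M N) b)
                     (g := amull b \o tau)) => m n /=.
  by rewrite !tensor_lactE !tauE lfunE /= /h -pl tensor_lactE.
have tau_s t : tau t * s = tau t.
  have -> : tau t * s = amulr s (tau t) by rewrite lfunE.
  apply: (tensor_ext (f := amulr s \o tau) (g := tau)) => m n /=.
  by rewrite !tauE lfunE /= /h -pr tensor_ractE -comp_lfunE -ractM ss.
have [c cE] := s_source (tau w).
have := tau_l a w; rewrite w_central tau_a pw1 mul1r -tau_s cE -scalerAr as0.
by rewrite scaler0 => s0; case/eqP: a_neq0; rewrite -sa s0 mul0r.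
Qed.
End DividesSelfInjective.

(** * Syzygies over a triangular algebra *)

Section FreeModule.
Variables (k : fieldType) (A : falgType k) (T : finType).
Implicit Types (K : {vspace {ffun T -> A}}) (x : {ffun T -> A}).

Definition mulv (a : A) x : {ffun T -> A} := [ffun t => a * x t].

Fact mulv_linear a : linear (mulv a).
Proof.
by move=> c x y; apply/ffunP => t; rewrite !ffunE mulrDr -scalerAr.
Qed.
HB.instance Definition _ a :=
  GRing.isLinear.Build k {ffun T -> A} {ffun T -> A} _ (mulv a) (mulv_linear a).

Definition submodule K := forall a x, x \in K -> mulv a x \in K.

(** The subspace [a K]; for [a] the idempotent of a vertex, the component of [K]
    at that vertex. *)
Definition corner (K : {vspace {ffun T -> A}}) a : {vspace {ffun T -> A}} :=
  (linfun (mulv a) @: K)%VS.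

Lemma corner_sub K a : submodule K -> (corner K a <= K)%VS.
Proof.
move=> K_sub; apply/subvP => _ /memv_imgP[x xK ->].
by rewrite lfunE; apply: K_sub.
Qed.

Lemma mem_corner K a x : x \in K -> mulv a x \in corner K a.
Proof. by move=> xK; rewrite -[mulv a x]lfunE memv_img. Qed.

Lemma corner_id K a x : a * a = a -> x \in corner K a -> mulv a x = x.
Proof.
move=> aa /memv_imgP[y _ ->]; rewrite lfunE; apply/ffunP => t.
by rewrite !ffunE mulrA aa.
Qed.

Section Presentation.
Variables (S : finType) (f : S -> A) (g : S -> {ffun T -> A}).

Definition idem_defect (p : {ffun S -> A}) : {ffun S -> A} :=
  [ffun s => p s - p s * f s].
Definition comb (p : {ffun S -> A}) : {ffun T -> A} :=
  [ffun t => \sum_s p s * g s t].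

Fact idem_defect_linear : linear idem_defect.
Proof.
move=> c p q; apply/ffunP => s.
by rewrite !ffunE mulrDl -scalerAl scalerBr opprD addrACA.
Qed.
HB.instance Definition _ :=
  GRing.isLinear.Build k {ffun S -> A} {ffun S -> A} _ idem_defect
    idem_defect_linear.

Fact comb_linear : linear comb.
Proof.
move=> c p q; apply/ffunP => t; rewrite !ffunE scaler_sumr -big_split.
by apply: eq_bigr => s _; rewrite !ffunE mulrDl -scalerAl.
Qed.
HB.instance Definition _ :=
  GRing.isLinear.Build k {ffun S -> A} {ffun T -> A} _ comb comb_linear.

(** The kernel of the map to the free module on [T] that sends the generators of
    the projective module with summands [A * f s] to the vectors [g s]. *)
Definition syzygy : {vspace {ffun S -> A}} :=
  (lker (linfun idem_defect) :&: lker (linfun comb))%VS.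

Lemma syzygyP (p : {ffun S -> A}) :
  reflect ((forall s, p s * f s = p s) /\ comb p = 0) (p \in syzygy).
Proof.
rewrite memv_cap !memv_ker !lfunE /=.
apply: (iffP andP) => -[pf pg]; split.
- by move=> s; move/eqP/ffunP/(_ s)/eqP: pf; rewrite !ffunE subr_eq0 => /eqP <-.
- exact/eqP.
- by apply/eqP/ffunP => s; rewrite !ffunE pf subrr.
- exact/eqP.
Qed.

Lemma comb_mem K (p : {ffun S -> A}) :
  submodule K -> (forall s, g s \in K) -> comb p \in K.
Proof.
move=> K_sub gK.
have -> : comb p = \sum_s mulv (p s) (g s).
  apply/ffunP => t; rewrite sum_ffunE ffunE.
  by apply: eq_bigr => s _; rewrite ffunE.
by apply: memv_suml => s _; apply: K_sub.
Qed.

End Presentation.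
End FreeModule.

Lemma syzygy_submodule (k : fieldType) (A : falgType k) (S T : finType)
  (f : S -> A) (g : S -> {ffun T -> A}) : submodule (syzygy f g).
Proof.
move=> a p /syzygyP[pf pg]; apply/syzygyP; split=> [s|].
  by rewrite ffunE -mulrA pf.
apply/ffunP => t; move/ffunP/(_ t): pg; rewrite !ffunE => pg.
by under eq_bigr do rewrite ffunE -mulrA; rewrite -mulr_sumr pg mulr0.
Qed.

Definition supported_below (k : fieldType) (A : falgType k) (V T : finType)
    (e : V -> A) (h : V -> nat) n (K : {vspace {ffun T -> A}}) :=
  forall y x, x \in K -> (n <= h y)%N -> mulv (e y) x = 0.

(** The generators of [K] are chosen adapted to the vertices: a basis of the
    component of [K] at each vertex [y], each basis vector being the image of
    a generator of a copy of [A * e y].  Independence of these vectors is what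
    makes the rank of the syzygy drop. *)
Section ProjectiveCover.
Variables (k : fieldType) (A : falgType k) (V T : finType).
Variables (e : V -> A) (h : V -> nat).
Hypothesis e_tri : triangular_idempotents e h.
Variable K : {vspace {ffun T -> A}}.
Hypothesis K_sub : submodule K.

Definition gen_index := {y : V & 'I_(\dim (corner K (e y)))}.
Definition at_gen y (j : 'I_(\dim (corner K (e y)))) : gen_index :=
  Tagged (fun z => 'I_(\dim (corner K (e z)))) j.
Definition gen_idem (s : gen_index) : A := e (tag s).
Definition gen_vec (s : gen_index) : {ffun T -> A} :=
  (vbasis (corner K (e (tag s))))`_(tagged s).

Lemma gen_vec_corner s : gen_vec s \in corner K (e (tag s)).
Proof. by apply: vbasis_mem; rewrite mem_nth // size_tuple. Qed.

Lemma gen_vec_mem s : gen_vec s \in K.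
Proof. exact: subvP (corner_sub _ K_sub) _ (gen_vec_corner s). Qed.

Lemma gen_vec_idem s t : gen_idem s * gen_vec s t = gen_vec s t.
Proof.
have /ffunP/(_ t) := corner_id (idem_id e_tri (tag s)) (gen_vec_corner s).
by rewrite ffunE.
Qed.

Lemma comb_sig (p : {ffun gen_index -> A}) t :
  comb gen_vec p t = \sum_y \sum_(j < \dim (corner K (e y)))
    p (at_gen j) * (vbasis (corner K (e y)))`_j t.
Proof.
rewrite ffunE.
rewrite (sig_big_dep _ (fun _ => xpredT)
  (fun y (j : 'I_(\dim (corner K (e y)))) =>
    p (at_gen j) * (vbasis (corner K (e y)))`_j t)) /=.
by apply: eq_bigr => -[y j] _.
Qed.

Lemma gen_surj x : x \in K -> exists p, comb gen_vec p = x.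
Proof.
move=> xK; pose c y := coord (vbasis (corner K (e y))) ^~ (mulv (e y) x).
exists [ffun s : gen_index => c (tag s) (tagged s) *: e (tag s)].
apply/ffunP => t; rewrite comb_sig [RHS](peirce_left e_tri).
apply: eq_bigr => y _.
have -> : e y * x t = mulv (e y) x t by rewrite ffunE.
rewrite {1}(coord_vbasis (mem_corner (e y) xK)) sum_ffunE.
apply: eq_bigr => j _; rewrite !ffunE /= -scalerAl; congr (_ *: _).
exact: (gen_vec_idem (at_gen j)).
Qed.

(** At a vertex [l] of rank at least [n], a summand [A * e y] has no component
    unless [y = l], by triangularity or because [K] has no generator at [y].
    The component of [A * e l] at [l] is a line, so an element of the syzygy
    gives there a linear relation between basis vectors of [corner K (e l)],
    which is trivial. *)
Lemma syzygy_supported n : supported_below e h n.+1 K ->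
  supported_below e h n (syzygy gen_idem gen_vec).
Proof.
move=> K_supp l p /syzygyP[pf pg] nl.
have corner0 y : (h l < h y)%N -> corner K (e y) = 0%VS.
  move=> ly; apply/eqP; rewrite -subv0; apply/subvP => _ /memv_imgP[x xK ->].
  by rewrite lfunE /= K_supp ?mem0v //; apply: leq_ltn_trans ly.
have off0 s : l != tag s -> e l * p s = 0.
  move=> ls; rewrite -pf mulrA; apply: (idem_upper e_tri) => //.
  rewrite leqNgt; apply/negP => /corner0 s0.
  by case: (s) s0 => y [j j_lt] /= y0; move: (j_lt); rewrite y0 dimv0.
have /choice[c cE] (j : 'I_(\dim (corner K (e l)))) :
    exists x : k, e l * p (at_gen j) = x *: e l.
  have [x xE] := idem_diag e_tri l (p (at_gen j)).
  by exists x; rewrite -pf mulrA.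
have c0 j : c j = 0.
  have /freeP := basis_free (vbasisP (corner K (e l))); apply.
  apply/ffunP => t; rewrite sum_ffunE [RHS]ffunE.
  have /(congr1 ( *%R (e l))) : comb gen_vec p t = 0 by rewrite pg ffunE.
  rewrite mulr0 comb_sig mulr_sumr (bigD1 l) //= [X in _ + X]big1 ?addr0.
    move=> pg0; rewrite -[RHS]pg0 mulr_sumr; apply: eq_bigr => i _.
    rewrite ffunE mulrA cE -scalerAl; congr (_ *: _).
    exact/esym/(gen_vec_idem (at_gen i)).
  move=> y yl; rewrite mulr_sumr big1 // => j' _.
  by rewrite mulrA off0 ?mul0r //= eq_sym.
apply/ffunP => -[y j]; rewrite !ffunE.
have [ly|ly] := eqVneq l y; last exact: off0.
by case: _ / ly j => j; rewrite cE c0 scale0r.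
Qed.

End ProjectiveCover.

(** * Inducing submodules of free modules *)

Section Induced.
Variables (k : fieldType) (A B : falgType k) (M : bimod B A).
Notation LM := (left_module M).

Definition right_comb (S T : finType) (G : S -> T -> A) (x : {ffun S -> LM}) :
  {ffun T -> LM} := [ffun t => \sum_s (ract_left M (G s t) (x s))].

Fact right_comb_linear (S T : finType) (G : S -> T -> A) :
  linear (right_comb G).
Proof.
move=> b x y; apply/ffunP => t; rewrite !ffunE scaler_sumr -big_split.
by apply: eq_bigr => s _; rewrite !ffunE linearP.
Qed.
HB.instance Definition _ (S T : finType) (G : S -> T -> A) :=
  GRing.isLinear.Build B {ffun S -> LM} {ffun T -> LM} _ (@right_comb S T G)
    (@right_comb_linear S T G).

Definition right_scale (S : finType) (f : S -> A) (x : {ffun S -> LM}) :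
  {ffun S -> LM} := [ffun s => ract_left M (f s) (x s)].

Fact right_scale_linear (S : finType) (f : S -> A) : linear (right_scale f).
Proof. by move=> b x y; apply/ffunP => s; rewrite !ffunE linearP. Qed.
HB.instance Definition _ (S : finType) (f : S -> A) :=
  GRing.isLinear.Build B {ffun S -> LM} {ffun S -> LM} _ (@right_scale S f)
    (@right_scale_linear S f).

Variable phi : 'I_(\dim {:M}) -> {linear M -> A}.
Hypothesis phiM : forall i a x, phi i (ract M a x) = phi i x * a.
Hypothesis phiE : forall x, x = \sum_i ract M (phi i x) (vbasis {:M})`_i.

Definition coords (T : finType) i (x : {ffun T -> LM}) : {ffun T -> A} :=
  [ffun t => phi i (x t)].

(** The submodule [M K] of a power of [M], spanned by the products of [M] with
    vectors of [K]; because of the dual basis it is cut out by coordinates. *)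
Definition induced (T : finType) (K : {vspace {ffun T -> A}})
  (x : {ffun T -> LM}) : Prop := forall i, coords i x \in K.

Lemma coords_eq0 (T : finType) (x : {ffun T -> LM}) :
  (forall i, coords i x = 0) -> x = 0.
Proof.
move=> x0; apply/ffunP => t; rewrite [LHS]phiE big1 ?ffunE // => i _.
by have /ffunP/(_ t) := x0 i; rewrite !ffunE => ->; rewrite linear0 lfunE.
Qed.

Lemma coords0 (T : finType) i : coords i (0 : {ffun T -> LM}) = 0.
Proof. by apply/ffunP => t; rewrite !ffunE linear0. Qed.

Lemma coords_comb (S T : finType) (g : S -> {ffun T -> A}) i x :
  coords i (right_comb g x) = comb g (coords i x).
Proof.
apply/ffunP => t; rewrite !ffunE linear_sum; apply: eq_bigr => s _.
by rewrite ffunE -phiM.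
Qed.

Lemma right_comb_surj (S T : finType) (g : S -> {ffun T -> A})
    (K : {vspace {ffun T -> A}}) (y : {ffun T -> LM}) :
    (forall x, x \in K -> exists p, comb g p = x) -> induced K y ->
  exists z, right_comb g z = y.
Proof.
move=> K_gen yK; have /choice[p pE] i := K_gen _ (yK i).
exists [ffun s => \sum_i ract M (p i s) (vbasis {:M})`_i : LM].
apply/ffunP => t; rewrite ffunE [RHS]phiE.
under eq_bigr => s _ do rewrite ffunE linear_sum.
rewrite exchange_big; apply: eq_bigr => i _ /=.
have /ffunP/(_ t) := pE i; rewrite !ffunE => <-.
rewrite linear_sum sum_lfunE; apply: eq_bigr => s _.
by rewrite ractM lfunE.
Qed.

(** Present [K] by the projective module of [gen_idem] and [gen_vec].  By
    induction the part induced from the syzygy is a summand, so the part induced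
    from the projective module is, modulo a summand, isomorphic to the part
    induced from [K].  A complement of that summand is a summand of a power of
    [M], hence injective, and so its isomorphic image splits off. *)
Lemma induced_summand (V : finType) (e : V -> A) (h : V -> nat) :
    triangular_idempotents e h -> injective_module (LM : lmodType B) ->
  forall n (T : finType) (K : {vspace {ffun T -> A}}),
    submodule K -> supported_below e h n K ->
  exists pi : {linear {ffun T -> LM} -> {ffun T -> LM}},
    (forall x, induced K (pi x)) /\ (forall x, induced K x -> pi x = x).
Proof.
move=> e_tri M_inj; elim=> [|n IHn] T K K_sub K_supp.
  have K0 x : x \in K -> x = 0.
    move=> xK; apply/ffunP => t; rewrite [LHS](peirce_left e_tri) ffunE.
    rewrite big1 // => y _.
    have -> : e y * x t = mulv (e y) x t by rewrite ffunE.
    by rewrite (K_supp y x xK isT) ffunE.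
  exists \0; split=> [x i|x xK].
    by rewrite /= coords0 mem0v.
  by apply/esym/coords_eq0 => i; apply: K0.
pose f := gen_idem (e := e) (K := K); pose g := gen_vec (e := e) (K := K).
have fg s t : f s * g s t = g s t by exact: (gen_vec_idem e_tri s t).
have ff s : f s * f s = f s by exact: (idem_id e_tri (tag s)).
have [pi [pi_in pi_id]] :=
  IHn _ _ (@syzygy_submodule _ _ _ _ f g) (syzygy_supported e_tri K_supp).
have syz0 x : induced (syzygy f g) x -> right_comb g x = 0.
  move=> x_syz; apply: coords_eq0 => i; rewrite coords_comb.
  by have /syzygyP[] := x_syz i.
have comb_scale x : right_comb g (right_scale f x) = right_comb g x.
  apply/ffunP => t; rewrite !ffunE; apply: eq_bigr => s _.
  by rewrite ffunE /= -comp_lfunE -ractM fg.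
(* The projection onto the complement of the induced syzygy; it has the same
   kernel as the map [right_comb g] and so factors through it. *)
pose v : {linear {ffun _ -> LM} -> {ffun _ -> LM}} :=
  right_scale f \- (pi \o right_scale f).
have ker_sub x : right_comb g x = 0 -> v x = 0.
  move=> gx0; rewrite /v /= pi_id ?subrr // => i; apply/syzygyP; split.
    by move=> s; rewrite !ffunE phiM -mulrA ff.
  rewrite -coords_comb comb_scale gx0.
  exact: coords0.
have [r rE] := injective_ext (ffun_injective M_inj) ker_sub.
exists (right_comb g \o r); split=> [x i|y yK] /=.
  by rewrite coords_comb; apply: comb_mem => // s; apply: gen_vec_mem.
have [z <-] := right_comb_surj (gen_surj e_tri (K := K)) yK.
by rewrite rE /v /= linearB /= comb_scale (syz0 (pi _)) ?subr0.
Qed.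

End Induced.

(** * A self-injective algebra dividing a directed one *)

Section TensorSpan.
Variables (k : fieldType) (A B C : falgType k) (M : bimod A B) (N : bimod B C).

Lemma tens_suml I (r : seq I) (F : I -> M) (n : N) :
  tens (\sum_(i <- r) F i) n = \sum_(i <- r) tens (F i) n.
Proof.
have [tl _] := bilinear_mapE (tens_bilinear M N).
apply: (big_morph (fun m => tens m n)) => [m m'|].
  by have := tl 1 m m' n; rewrite !scale1r.
by have := tl (-1) 0 0 n; rewrite !scaleN1r oppr0 addr0 addNr.
Qed.

Lemma tens_sumr I (r : seq I) (F : I -> N) (m : M) :
  tens m (\sum_(i <- r) F i) = \sum_(i <- r) tens m (F i).
Proof.
have [_ tr] := bilinear_mapE (tens_bilinear M N).
apply: (big_morph (fun n => tens m n)) => [n n'|].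
  by have := tr 1 m n n'; rewrite !scale1r.
by have := tr (-1) m 0 0; rewrite !scaleN1r oppr0 addr0 addNr.
Qed.

Lemma tens_scalel c (m : M) (n : N) : tens (c *: m) n = c *: tens m n.
Proof.
have [tl _] := bilinear_mapE (tens_bilinear M N).
have t0 : tens 0 n = 0 :> tensor M N.
  by have := tl (-1) 0 0 n; rewrite !scaleN1r oppr0 addr0 addNr.
by rewrite -[c *: m]addr0 tl t0 addr0.
Qed.

Lemma tensor_spanned (w : tensor M N) :
  exists x : 'I_(\dim {:N}) -> M, w = \sum_j tens (x j) (vbasis {:N})`_j.
Proof.
pose X := vsval (w : tensor_space M N).
exists (fun j => \sum_i X i j *: (vbasis {:M})`_i).
rewrite -[LHS](tensor_projK w) [X in tensor_proj X]matrix_sum_delta linear_sum.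
under [RHS]eq_bigr do rewrite tens_suml.
rewrite [RHS]exchange_big; apply: eq_bigr => i _; rewrite linear_sum.
by apply: eq_bigr => j _; rewrite tens_scalel linearZ -outer_basis.
Qed.

End TensorSpan.

Section DividesDirected.
Variables (k : fieldType) (A B : falgType k) (M : bimod B A) (N : bimod A B).
Hypotheses (M_proj : left_right_projective M) (B_inj : self_injective B).
Hypothesis B_summand : direct_summand (regular_bimod B) (tensor M N).
Variables (V : finType) (e : V -> A) (h : V -> nat).
Hypothesis e_tri : triangular_idempotents e h.

(** Present [N] by the free module on its basis through [act], and let [K] be
    the preimage of the largest submodule of [N] whose tensors with [M] are
    sent to [U] by [p].  If [pi] projects onto the summand induced from [K],
    then [b |-> p (Theta (pi (b *: x0)))], with [Theta x0 = w], is left linear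
    with values in [U].  It is the identity on [U]: for [b] in [U] the vector
    [b *: x0] is induced from [K], because [b w = w b]. *)
Lemma left_ideal_right_unit (U : {vspace B}) : left_ideal U ->
  exists2 u, u \in U & forall b, b \in U -> b * u = b.
Proof.
move/left_idealP=> U_left.
have M_inj := left_injective M_proj.1 B_inj.
have [phi [phiM phiE]] := right_dual_basis M_proj.2.
have [w [p [pw1 w_central pl pr]]] := separating_element B_summand.
have [_ tr] := bilinear_mapE (tens_bilinear M N).
have [c0 wE] := tensor_spanned w.
pose T := 'I_(\dim {:N}).
pose act (a : {ffun T -> A}) : N := \sum_t lact N (a t) (vbasis {:N})`_t.
have act_lin : linear act.
  move=> c a b; rewrite /act scaler_sumr -big_split; apply: eq_bigr => t _.
  by rewrite !ffunE linearP !lfun_simp.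
have act_mulv b a : act (mulv b a) = lact N b (act a).
  rewrite /act linear_sum; apply: eq_bigr => t _.
  by rewrite ffunE lactM lfunE.
have pact_lin m : linear (fun a => p (tens m (act a))).
  by move=> c a b; rewrite act_lin tr linearP.
pose pact m : {linear {ffun T -> A} -> B} :=
  HB.pack (fun a => p (tens m (act a)))
    (GRing.isLinear.Build _ _ _ _ _ (pact_lin m)).
pose K := (\bigcap_(i < \dim {:M}) (linfun (pact (vbasis {:M})`_i) @^-1: U))%VS.
have memK a : a \in K <-> forall m, p (tens m (act a)) \in U.
  split=> [|aU]; last first.
    rewrite memvE; apply/subv_bigcapP => i _; rewrite -memvE -memv_preim lfunE.
    exact: aU.
  rewrite memvE => /subv_bigcapP aK m; rewrite (coord_vbasis (memvf m)).
  rewrite tens_suml linear_sum memv_suml // => i _.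
  rewrite tens_scalel linearZ memvZ //.
  by have := aK i isT; rewrite -memvE -memv_preim lfunE.
have K_sub : submodule K.
  move=> b a /memK aK; apply/memK => m; rewrite act_mulv -tens_balanced.
  exact: aK.
have K_supp : supported_below e h (\max_y h y).+1 K.
  by move=> y x _; rewrite ltnNge leq_bigmax.
have [pi [pi_in pi_id]] := induced_summand phiM phiE e_tri M_inj K_sub K_supp.
pose Theta (x : {ffun T -> left_module M}) : tensor M N :=
  \sum_t tens (x t : M) (vbasis {:N})`_t.
have ThetaZ b x : Theta (b *: x) = lact (tensor M N) b (Theta x).
  rewrite linear_sum; apply: eq_bigr => t _.
  by rewrite ffunE /= tensor_lactE.
have Theta_mem x : induced phi K x -> p (Theta x) \in U.
  move=> xK.
  have -> : Theta x = \sum_(i < \dim {:M})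
      tens (vbasis {:M})`_i (act (coords phi i x)).
    under [RHS]eq_bigr do rewrite tens_sumr.
    rewrite exchange_big; apply: eq_bigr => t _.
    rewrite {1}[x t]phiE tens_suml; apply: eq_bigr => i _.
    by rewrite ffunE tens_balanced.
  by rewrite linear_sum memv_suml // => i _; apply: (memK _).1.
pose x0 : {ffun T -> left_module M} := [ffun t => c0 t : left_module M].
have Theta_x0 : Theta x0 = w.
  by rewrite wE; apply: eq_bigr => t _; rewrite ffunE.
have x0_induced b : b \in U -> induced phi K (b *: x0).
  move=> bU i; apply/memK => m.
  (* The map [sg] from the tensor product to [N] induced by [phi i] commutes
     with the right action, so that it sends [w b] into [N b]. *)
  pose s0 (m : M) (n : N) := lact N (phi i m) n.
  have s0_bilin : bilinear_map s0.
    split=> [n c m1 m2|m1 c n n']; last exact: linearP.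
    by rewrite /s0 linearP linearP !lfun_simp.
  have s0_bal : balanced_map s0.
    by move=> m1 a n; rewrite /s0 phiM lactM lfunE.
  pose sg : {linear tensor M N -> N} := tensor_lift s0.
  have sgE m1 n : sg (tens m1 n) = s0 m1 n by exact: tensor_liftE.
  have -> : act (coords phi i (b *: x0)) = sg (Theta (b *: x0)).
    rewrite linear_sum; apply: eq_bigr => t _.
    by rewrite sgE ffunE.
  rewrite ThetaZ Theta_x0 w_central.
  have -> : sg (ract (tensor M N) b w) = ract N b (sg w).
    apply: (tensor_ext (f := sg \o ract (tensor M N) b) (g := ract N b \o sg)).
    by move=> m1 n /=; rewrite tensor_ractE !sgE /s0 lractE.
  by rewrite -tensor_ractE pr U_left.
exists (p (Theta (pi x0))); first exact: Theta_mem.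
move=> b bU; rewrite -pl -ThetaZ -linearZ pi_id; last exact: x0_induced.
by rewrite ThetaZ pl Theta_x0 pw1 mulr1.
Qed.

End DividesDirected.

Theorem corollary41 (k : fieldType) (A B : falgType k)
    (A_nss : ~ semisimple A) (B_nss : ~ semisimple B)
    (A_dir : directed A) (B_si : self_injective B) :
  ~ separably_divides A B /\ ~ separably_divides B A.
Proof.
have [V [e [h e_tri]]] := directed_triangular A_dir.
split=> -[M [N [M_proj N_proj summand]]].
  have [s [a [s_source ss sa as0 /eqP[]]]] := exists_source_arrow e_tri A_nss.
  exact: (no_source_arrow N_proj B_si summand s_source ss sa as0).
apply: B_nss; apply: semisimple_of_right_units => U.
exact: (left_ideal_right_unit M_proj B_si summand e_tri).
Qed.
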